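(* Let $(X,d)$ be a compact metric space and let ${\bf m}$ be a Borel probability measure on $X$ such that the metric measure space $(X,d,{\bf m})$ is regular. Let $\mu\in P(X)$ and suppose that $B^N(\mu)=\mu$ for some positive integer $N$, where $B^N$ denotes the $N$-fold iterate of the map $B:P(X)\to P(X)$. Then $B^2(\mu)=\mu$.
   Context: $P(X)$ is the set of Borel probability measures on $X$ with the weak-* topology. For $\mu,\nu\in P(X)$, $W_2^2(\mu,\nu)=\inf_\gamma\int_{X\times X}d^2(x,y)\,d\gamma(x,y)$, where the infimum is over all Borel probability measures $\gamma$ on $X\times X$ with first marginal $\mu$ and second marginal $\nu$; $W_2\ge 0$ is its square root. For $\mu\in P(X)$, $b(\mu)=\operatorname{argmin}_{y\in X}\int_X d^2(x,y)\,d\mu(x)$ is the set of barycentric points of $\mu$. $(X,d,{\bf m})$ is called regular if for every $\nu\in P(X)$, any minimizer $\gamma$ in the definition of $W_2({\bf m},\nu)$ is concentrated on the graph of a function, that is, $\gamma=(\mathrm{Id},T)_\#{\bf m}$ for a map $T:X\to X$. When $(X,d,{\bf m})$ is regular, for $\mu\in P(X)$ and $\epsilon>0$ the functional $F_\epsilon(\nu)=\int_X\int_X d^2(y,x)\,d\mu(x)\,d\nu(y)+\epsilon W_2^2({\bf m},\nu)$ has a unique minimizer $\mu_\epsilon\in P(X)$, and the Wasserstein regularized barycenter $B(\mu)\in P(X)$ of $\mu$ is the weak-* limit of $\mu_\epsilon$ as $\epsilon\to0$ (which exists); equivalently, $B(\mu)$ is the unique minimizer of $\nu\mapsto W_2(\nu,{\bf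 m})$ among $\nu\in P(X)$ with $\operatorname{supp}\nu\subset b(\mu)$. *)

(* Defs.v *)
From HB Require Import structures.
From mathcomp Require Import all_boot all_order all_algebra.
From mathcomp Require Import all_classical all_reals all_analysis.
From mathcomp Require Import giry.

Set Implicit Arguments.
Unset Strict Implicit.
Unset Printing Implicit Defensive.

Import Order.TTheory GRing.Theory Num.Theory.
Import numFieldNormedType.Exports.

Local Open Scope classical_set_scope.
Local Open Scope ring_scope.
Local Open Scope ereal_scope.

(* Measurable types of the library are pointed, hence this join.  The chosen
   point only says that the space is nonempty, which already follows from the
   existence of a probability measure on it. *)
#[short(type="pointedMetricType")]
HB.structure Definition PointedMetric (K : numDomainType) :=
  {M of Metric K M & PseudoPointedMetric K M}.

HB.instance Definition _ (T U : ptopologicalType) := Pointed.on (T * U)%type.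

Notation borel T := (g_sigma_algebraType (@open T)).

Section borel_probability.
Context (R : realType) (X : ptopologicalType).

Definition integral_against (mu : probability (borel X) R) :
    prod_topology (fun _ : {f : X -> R | continuous f} => R) :=
  fun f => (\int[mu]_x (sval f x))%R.

(* P(X) with the weak-* topology, the coarsest one making every
   mu |-> \int f dmu with f continuous (hence bounded, as X is to be compact)
   continuous.

   Measures of the library are set functions on all subsets and are constrained
   only on the measurable ones, so that equality in P(X) is not Leibniz equality
   but agreement on Borel sets, [measure_eq], written ≡μ.  For the same reason
   the topology is Hausdorff only up to ≡μ, and [get] and [lim] below return
   one representative of a ≡μ-class. *)
Definition borel_probability : Type := initial_topology integral_against.

HB.instance Definition _ :=
  Topological.copy borel_probability (initial_topology integral_against).
HB.instance Definition _ :=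
  Pointed.copy borel_probability (initial_topology integral_against).

End borel_probability.

Section wasserstein.
Context (R : realType) (X : pointedMetricType R).

Notation P := (borel_probability R).

Definition couplings (mu nu : P X) : set (P (X * X)%type) :=
  [set gamma : P (X * X)%type | forall A : set (borel X), measurable A ->
     gamma (fst @^-1` A) = mu A /\ gamma (snd @^-1` A) = nu A].

Definition transport_cost (gamma : P (X * X)%type) : \bar R :=
  \int[gamma]_z (mdist z.1 z.2 ^+ 2)%:E.

Definition wasserstein2_sq (mu nu : P X) : \bar R :=
  ereal_inf [set transport_cost gamma | gamma in couplings mu nu].

Definition optimal_coupling (mu nu : P X) (gamma : P (X * X)%type) : Prop :=
  couplings mu nu gamma /\ transport_cost gamma = wasserstein2_sq mu nu.

(* T is required to be Borel, so that (Id, T)_# m is a Borel measure. *)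
Definition regular_mms (m : P X) : Prop :=
  forall (nu : P X) (gamma : P (X * X)%type), optimal_coupling m nu gamma ->
  exists T : borel X -> borel X, measurable_fun setT T /\
    forall A : set (borel (X * X)%type), measurable A ->
      gamma A = m ((fun x => (x, T x)) @^-1` A).

Definition regularized_functional (m mu : P X) (eps : R) (nu : P X) : \bar R :=
  (\int[nu]_y \int[mu]_x (mdist y x ^+ 2)%:E) + eps%:E * wasserstein2_sq m nu.

(* mu_eps, meaningful when the minimizer exists and is unique up to ≡μ, as is
   the case for eps > 0 and (X, d, m) compact and regular *)
Definition regularized_minimizer (m mu : P X) (eps : R) : P X :=
  get [set nu : P X | forall nu' : P X,
    regularized_functional m mu eps nu <= regularized_functional m mu eps nu'].

Definition wasserstein_reg_barycenter (m mu : P X) : P X :=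
  lim (regularized_minimizer m mu eps @[eps --> 0^'+]).

End wasserstein.

(* Main.v *)
Require Import Defs.
From HB Require Import structures.
From mathcomp Require Import all_boot all_order all_algebra.
From mathcomp Require Import all_classical all_reals all_analysis.
From mathcomp Require Import giry measurable_realfun.
From mathcomp Require Import lra.

Set Implicit Arguments.
Unset Strict Implicit.
Unset Printing Implicit Defensive.

Import Order.TTheory GRing.Theory Num.Theory.
Import numFieldNormedType.Exports.

Local Open Scope classical_set_scope.
Local Open Scope ring_scope.

(** Write [c x y = d(x,y)^2]. The pairing [V mu nu = \int \int c dmu dnu] is
    symmetric and [B mu] minimizes [V mu], so [V (B^k mu) (B^k+1 mu)] is
    nonincreasing in [k]; being periodic it is constant, hence [B^k mu] is itself
    a minimizer of [V (B^k+1 mu)]. Since [B^k+2 mu] is the minimizer nearest to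
    [m], [W_2(m, B^k+2 mu) <= W_2(m, B^k mu)]; along [k = 0, 2, ..., 2N] this is
    again periodic, so [mu] is a nearest minimizer of [V (B mu)], and uniqueness
    gives [mu = B^2 mu].

    That [B mu] is the unique nearest minimizer is obtained without compactness
    of the space of measures or existence of optimal plans. Let [phi] be the
    potential of [mu] and [K = argmin phi]. For a continuous [f] the elementary
    bound [\int psi dnu <= k W_2^2(m, nu) + \int sup_y (psi y - k c x y) dm],
    applied to [psi = f - n phi] with [n], then [k], going to infinity, bounds
    [\int f dnu] for every near minimizer [nu] of [F_eps] by the integral over [m]
    of the maximum of [f] over the points of [K] nearest to [x]. This maximum is
    reached by a Borel selection, and by regularity (applied to the half-sum of
    two plans) all Borel nearest-point selections have the same image measure. *)

(** * Maxima over compact sets and the penalty method *)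

Section maximum_on_compact.
Context {R : realType} {T : topologicalType}.
Implicit Types (S : set T) (f g u : T -> R).

Definition maxval S g : R := sup (g @` S).

Definition argmax S u : set T := [set y | S y /\ forall z, S z -> u z <= u y].

Lemma maxval_eq S g y : S y -> (forall z, S z -> g z <= g y) ->
  maxval S g = g y.
Proof.
move=> Sy gy; apply/eqP; rewrite eq_le; apply/andP; split.
  by apply: ge_sup; [exists (g y), y|move=> _ [z Sz <-]; exact: gy].
apply: ub_le_sup; last by exists y.
by exists (g y) => _ [z Sz <-]; exact: gy.
Qed.

Lemma argmax_maxval S g y : argmax S g y -> g y = maxval S g.
Proof. by case=> Sy gy; rewrite (maxval_eq Sy gy). Qed.

Lemma argmax_neq0 S g : S !=set0 -> compact S -> continuous g ->
  argmax S g !=set0.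
Proof.
move=> S0 cS cg.
have [|y yS gy] := compact_EVT_max S0 cS (f := g).
  exact: continuous_subspaceT.
exists y; split; first exact/set_mem.
by move=> z Sz; apply: gy; exact/mem_set.
Qed.

Lemma le_maxval S g z : compact S -> continuous g -> S z -> g z <= maxval S g.
Proof.
move=> cS cg Sz; have S0 : S !=set0 by exists z.
have [y ay] := argmax_neq0 S0 cS cg.
by rewrite -(argmax_maxval ay); exact: ay.2.
Qed.

Lemma maxval_le S g a : S !=set0 -> (forall z, S z -> g z <= a) ->
  maxval S g <= a.
Proof.
move=> [y Sy] ga; apply: ge_sup; first by exists (g y), y.
by move=> _ [z Sz <-]; exact: ga.
Qed.

Lemma eq_maxval S f g : (forall z, S z -> f z = g z) -> maxval S f = maxval S g.
Proof.
move=> fg; congr sup; by apply/seteqP; split=> _ [z Sz <-]; exists z; rewrite ?fg.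
Qed.

Lemma argmax_compact S u : compact S -> continuous u -> compact (argmax S u).
Proof.
move=> cS cu.
have aE : argmax S u = S `&` u @^-1` [set r | maxval S u <= r].
  apply/seteqP; split=> y /=.
    by move=> ay; rewrite (argmax_maxval ay); split => //; exact: ay.1.
  by move=> [Sy uy]; split => // z Sz; apply: le_trans uy; exact: le_maxval.
rewrite aE; by apply: compact_closedI => //; apply: preimage_closed.
Qed.

(** The penalty [n * (u - maxval S u)] vanishes on [argmax S u] and is nonpositive on the rest of
    [S]. The outer terms do not depend on [n], so they also serve for domination under an
    integral. *)
Lemma maxval_penalized_bounds S g u n :
  S !=set0 -> compact S -> continuous g -> continuous u ->
  maxval (argmax S u) g <= maxval S (fun y => g y + n%:R * u y)
    - n%:R * maxval S u <= maxval S g.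
Proof.
move=> S0 cS cg cu.
have cgu : continuous (fun y => g y + n%:R * u y).
  by move=> y; apply: cvgD; [exact: cg|apply: cvgM; [exact: cvg_cst|exact: cu]].
apply/andP; split.
  apply: maxval_le; first exact: argmax_neq0.
  move=> z az; rewrite lerBrDr -(argmax_maxval az).
  exact: (le_maxval (g := fun y => g y + n%:R * u y) cS cgu az.1).
rewrite lerBlDr; apply: maxval_le => // z Sz; apply: lerD.
  exact: le_maxval.
by apply: ler_wpM2l => //; exact: le_maxval.
Qed.

(** A point that does not maximize [u] loses an amount linear in [n]; compactness makes this loss
    uniform over the points where [g] exceeds the limit by [e]. *)
Lemma maxval_penalized_cvg S g u :
  S !=set0 -> compact S -> continuous g -> continuous u ->
  maxval S (fun y => g y + n%:R * u y) - n%:R * maxval S u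
    @[n --> \oo] --> maxval (argmax S u) g.
Proof.
move=> S0 cS cg cu.
pose G := maxval (argmax S u) g.
have aG z : argmax S u z -> g z <= G.
  by apply: le_maxval => //; exact: argmax_compact.
have cgu n : continuous (fun y => g y + n%:R * u y).
  by move=> y; apply: cvgD; [exact: cg|apply: cvgM; [exact: cvg_cst|exact: cu]].
apply/cvgrPdist_le => e e0.
suff [N HN] : exists N : nat, forall n, (N <= n)%N -> forall y, S y ->
    g y + n%:R * u y <= G + e + n%:R * maxval S u.
  exists N => // n /= Nn; rewrite distrC ger0_norm; last first.
    by rewrite subr_ge0; case/andP: (maxval_penalized_bounds n S0 cS cg cu).
  rewrite -/G lerBlDr lerBlDr [e + _]addrC; apply: maxval_le => // y Sy.
  exact: HN.
(* The points where [g] is too large. None of them maximizes [u], so on this compact set [u] stays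
   below its maximum by some [delta > 0]. *)
pose S' := S `&` g @^-1` [set r | G + e <= r].
have cS' : compact S'.
  by apply: compact_closedI => //; apply: preimage_closed.
have near y : S y -> ~ S' y -> forall n, g y + n%:R * u y <= G + e + n%:R * maxval S u.
  move=> Sy nS' n; apply: lerD.
    by rewrite leNgt; apply/negP => gy; apply: nS'; split => //=; exact: ltW.
  by apply: ler_wpM2l => //; exact: le_maxval.
have [S'0|S'0] := pselect (S' !=set0); last first.
  by exists 0%N => n _ y Sy; apply: near => // S'y; apply: S'0; exists y.
have [y0 ay0] := argmax_neq0 S'0 cS' cu.
pose delta := maxval S u - u y0.
have d0 : 0 < delta.
  rewrite subr_gt0 lt_neqAle le_maxval ?andbT//; last exact: ay0.1.1.
  apply/eqP => uy0; have := ay0.1.2 => /=; apply/negP; rewrite -ltNge.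
  suff : g y0 <= G by move=> h; rewrite (le_lt_trans h)// ltrDl.
  apply: aG; split; first exact: ay0.1.1.
  by move=> z Sz; rewrite uy0; exact: le_maxval.
(* From this [N] on, the loss [n * delta] covers the largest possible excess of [g] over [G]. *)
have [N _ HN] := nbhs_infty_ger ((maxval S g - G) / delta).
exists N => n Nn y Sy; have [S'y|] := pselect (S' y); last by move=> ?; exact: near.
have gy := le_maxval cS cg Sy.
have uy : n%:R * u y <= n%:R * u y0 by apply: ler_wpM2l => //; exact: ay0.2.
have := HN n Nn; rewrite /= ler_pdivrMr// /delta mulrBr => ?.
lra.
Qed.

End maximum_on_compact.

(** * Lexicographic maximization on a compact space *)

Section lexicographic_argmax.
Context {R : realType} {T : ptopologicalType}.
Hypothesis Tcompact : compact [set: T].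

Fixpoint lexargmax (h : (T -> R)^nat) n : set T :=
  if n is n'.+1 then argmax (lexargmax h n') (h n') else setT.

Lemma lexargmax_prop (h : (T -> R)^nat) n : (forall i, continuous (h i)) ->
  lexargmax h n !=set0 /\ compact (lexargmax h n).
Proof.
move=> ch; elim: n => [|n [S0 cS]] /=; first by split => //; exists point.
by split; [exact: argmax_neq0|exact: argmax_compact].
Qed.

(** The stages are nonempty, closed and nested. If their complements covered the space, finitely
    many would, and the stage with the largest of these indices would be empty. *)
Lemma lexargmax_capP (h : (T -> R)^nat) : (forall i, continuous (h i)) ->
  hausdorff_space T -> exists y, forall n, lexargmax h n y.
Proof.
move=> ch hT; absurd_not => nex.
have cl i : closed (lexargmax h i).
  by apply: compact_closed => //; case: (lexargmax_prop i ch).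
have dec i j : (i <= j)%N -> lexargmax h j `<=` lexargmax h i.
  by move=> /subnK <-; elim: (j - i)%N => [//|k IH] y; rewrite addSn => -[/IH].
have := Tcompact; rewrite compact_cover => /(_ _ setT (fun i => ~` lexargmax h i)).
case.
- by move=> i _; exact: closed_openC.
- move=> y _; have [i ni] := nex y.
  by exists i.
- move=> D _ cov.
  pose N := (\max_(i <- finmap.enum_fset D) i)%N.
  have [[y Ny] _] := lexargmax_prop N ch.
  have [i /= iD ni] := cov y I.
  apply: ni; apply: dec Ny; rewrite /N.
  exact: (@leq_bigmax_seq _ _ xpredT id).
Qed.

End lexicographic_argmax.

(** * Dense sequences and continuity of the distance *)

Lemma countable_dense_seq {T : ptopologicalType} : @second_countable T ->
  exists q : nat -> T, dense (range q).
Proof.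
move=> [B /countable_injP[f fI] [oB bB]].
(* [f] codes the countable base injectively by integers; [P n] is the member with code [n], empty if
   there is none, and [get] picks a point in it. *)
pose P n : set T := [set x | exists U, [/\ B U, f U = n & U x]].
exists (fun n => get (P n)) => O [x Ox] oO.
have [U [BU Ux] UO] : filter_from [set U | B U /\ U x] id O.
  by apply: bB; exact: open_nbhs_nbhs.
have [V [BV fVU Vq]] : P (f U) (get (P (f U))).
  by apply: (@getI _ _ x); exists U.
have VU : V = U by apply: fI => //; exact/mem_set.
exists (get (P (f U))); split; last by exists (f U).
by apply: UO; rewrite VU in Vq.
Qed.

Section metric_continuity.
Context {R : realType} {X : metricType R}.

Lemma mdist_pair_continuous :
  continuous (fun z : X * X => mdist z.1 z.2 : R^o).
Proof.
move=> [a b]; apply/cvgrPdist_lt => e e0.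
have e20 : 0 < e / 2 by rewrite divr_gt0.
exists (ball a (e / 2), ball b (e / 2)); first by split; exact: nbhsx_ballx.
move=> [x y] [/=]; rewrite !ballEmdist/= => ax ay.
have xa := metric_sym x a; have yb := metric_sym y b.
have := metric_triangle a x b; have := metric_triangle x y b.
have := metric_triangle x a y; have := metric_triangle a b y.
by rewrite ltr_norml => ????; apply/andP; split; lra.
Qed.

Lemma mdist_continuous (x : X) : continuous (mdist x : X -> R^o).
Proof.
move=> y; apply: (continuous_comp (f := fun z => (x, z))
  (g := fun z : X * X => mdist z.1 z.2 : R^o)).
  by apply: cvg_pair; [exact: cvg_cst|exact: cvg_id].
exact: mdist_pair_continuous.
Qed.

End metric_continuity.

(** * Measurability of maps into separable metric spaces *)

Section borel_separable.
Context {R : realType} {X : pointedMetricType R}.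
Variable q : nat -> X.
Hypothesis dense_q : dense (range q).

Let B (i k : nat) : set X := [set y | mdist (q i) y < k.+1%:R^-1].

Lemma nbhs_ball_dense (x : X) (U : set X) : nbhs x U ->
  exists ik : nat * nat, B ik.1 ik.2 x /\ B ik.1 ik.2 `<=` U.
Proof.
move=> /nbhs_ballP[e /= e0 eU].
have [k] := ltr_add_invr (y := 0) (x := e / 2) (divr_gt0 e0 (ltr0Sn _ 1)).
rewrite add0r => ke.
have [|y [ky [i _ qi]]] := dense_q (O := (ball x k.+1%:R^-1)°) _ (open_interior _).
  by exists x; apply: nbhs_singleton; apply: nbhs_interior; apply: nbhsx_ballx.
move: ky => /interior_subset; rewrite ballEmdist/= -qi => xq.
exists (i, k); split=> [|y' /=]; first by rewrite /B/= metric_sym.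
move=> qy; apply: eU; rewrite ballEmdist/=.
apply: le_lt_trans (metric_triangle x (q i) y') _.
rewrite (splitr e); apply: ltrD; first exact: lt_trans xq ke.
exact: lt_trans qy ke.
Qed.

Context d (A : measurableType d).

(** An open set is a countable union of balls [B i k], whose preimages are sublevel sets of the
    distances to the dense points. *)
Lemma measurable_to_borel (T : A -> borel X) :
  (forall i, measurable_fun setT (fun x => mdist (q i) (T x : X))) ->
  measurable_fun setT T.
Proof.
move=> mT; apply: (@measurability _ _ A (borel X) setT T (@open X)) => //.
move=> _ [U oU <-]; rewrite setTI.
pose F (ik : nat * nat) := if `[< B ik.1 ik.2 `<=` U >] then T @^-1` B ik.1 ik.2 else set0.
have -> : T @^-1` U = \bigcup_(ik in setT) F ik.
  apply/seteqP; split=> x /=.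
    move=> Ux; have /nbhs_ball_dense[ik [Bx BU]] := open_nbhs_nbhs (conj oU Ux).
    by exists ik => //; rewrite /F; case: asboolP.
  by move=> [ik _]; rewrite /F; case: asboolP => // BU /BU.
apply: countable_bigcupT_measurable => // ik; rewrite /F; case: asboolP => // _.
rewrite -[X in measurable X]setTI.
have := mT ik.1 measurableT _ (measurable_itv `]-oo, ik.2.+1%:R^-1[).
by rewrite /B; congr measurable; apply/seteqP; split=> x /=; rewrite in_itv.
Qed.

(** The Borel sigma-algebra of [X * X] is not by definition the product one; separability bridges
    the two, each open set being a countable union of products of balls. *)
Lemma measurable_to_borel_pair (f g : A -> borel X) :
  measurable_fun setT f -> measurable_fun setT g ->
  measurable_fun setT ((fun x => (f x, g x)) : A -> borel (X * X)%type).
Proof.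
move=> mf mg; apply: (@measurability _ _ A (borel (X * X)%type) setT _ (@open (X * X)%type)) => //.
move=> _ [U oU <-]; rewrite setTI.
pose F (p : (nat * nat) * (nat * nat)) :=
  if `[< B p.1.1 p.1.2 `*` B p.2.1 p.2.2 `<=` U >]
  then f @^-1` B p.1.1 p.1.2 `&` g @^-1` B p.2.1 p.2.2 else set0.
have -> : (fun x => (f x, g x)) @^-1` U = \bigcup_(ik in setT) F ik.
  apply/seteqP; split=> x /=.
    move=> Ux; have [[V W] /= [fV gW] VWU] := open_nbhs_nbhs (conj oU Ux).
    have [ik [Bf BV]] := nbhs_ball_dense fV.
    have [jl [Bg BW]] := nbhs_ball_dense gW.
    exists (ik, jl) => //; rewrite /F; case: asboolP => //=; case=> -[y z] [/=] /BV Vy /BW Wz.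
    exact: VWU.
  by move=> [p _]; rewrite /F; case: asboolP => // BU [? ?]; exact: BU.
have oB i k : open (B i k).
  by rewrite /B; apply: (@open_comp _ _ (mdist (q i)) [set r | r < k.+1%:R^-1]) => [y _|];
   [exact: mdist_continuous|exact: open_lt].
apply: countable_bigcupT_measurable => // p; rewrite /F; case: asboolP => // _.
by apply: measurableI; rewrite -[X in measurable X]setTI;
  [apply: mf|apply: mg] => //; apply: sub_sigma_algebra; exact: oB.
Qed.

End borel_separable.

(** * Measurability of parametrized maxima *)

Section measurable_selection.
Context {R : realType} {X : pointedMetricType R}.
Hypothesis Xcompact : compact [set: X].
Context d (A : measurableType d).

Definition caratheodory (g : A -> X -> R) :=
  (forall y, measurable_fun setT (fun x => g x y)) /\
  (forall x, continuous (g x)).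

Lemma caratheodoryD g k u : caratheodory g -> caratheodory u ->
  caratheodory (fun x y => g x y + k * u x y).
Proof.
move=> [mg cg] [mu cu]; split=> [y|x y].
  by apply: measurable_funD => //; apply: measurable_funM.
by apply: cvgD; [exact: cg|apply: cvgM; [exact: cvg_cst|exact: cu]].
Qed.

(** By continuity in the point, the maximum is the supremum along a dense sequence, hence a
    countable supremum of measurable functions. *)
Lemma measurable_maxval_setT g : caratheodory g ->
  measurable_fun setT (fun x => maxval setT (g x)).
Proof.
move=> [mg cg].
have [q dq] := countable_dense_seq (compact_second_countable Xcompact).
have ub x : ubound (range (fun n => g x (q n))) (maxval setT (g x)).
  by move=> _ [n _ <-]; exact: le_maxval.
apply: (@eq_measurable_fun _ _ _ _ _ (fun x => sups (fun n => g x (q n)) 0)).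
  have supsE x : sups (fun n => g x (q n)) 0 = sup (range (fun n => g x (q n))).
    by congr sup; apply/seteqP; split=> _ [k _ <-]; exists k.
  move=> x _; rewrite supsE; apply/eqP; rewrite eq_le; apply/andP; split.
    apply: ge_sup; first by exists (g x (q 0%N)), 0%N.
    by move=> _ [n _ <-]; apply: ub; exists n.
  apply: maxval_le => [|z _]; first by exists point.
  rewrite leNgt; apply/negP => lt.
  have [||y [ltq [n _ qn]]] := dq [set y | sup (range (fun n => g x (q n))) < g x y].
  - by exists z.
  - apply: (@open_comp _ _ (g x) [set r | _ < r]) => [y _|]; first exact: cg.
    exact: open_gt.
  move: ltq => /=; rewrite -qn; apply/negP; rewrite -leNgt.
  by apply: ub_le_sup; [exists (maxval setT (g x)); exact: ub|exists n].
apply: (@measurable_fun_sups _ _ _ _ (fun n x => g x (q n))) => [x _|n].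
  by exists (maxval setT (g x)); exact: ub.
exact: mg.
Qed.

Variable h : nat -> A -> X -> R.
Hypothesis hC : forall i, caratheodory (h i).

Let ch x i : continuous (h i x).
Proof. exact: (hC i).2. Qed.

Let S n x := lexargmax (fun i => h i x) n.

(** Induction on the stage, for all [g] at once: by the penalty method, the maximum over stage
    [n.+1] is a pointwise limit of combinations of maxima over stage [n]. *)
Lemma measurable_maxval_lexargmax n g : caratheodory g ->
  measurable_fun setT (fun x => maxval (S n x) (g x)).
Proof.
elim: n g => [|n IH] g gC; first exact: measurable_maxval_setT.
apply: (@measurable_fun_cvg _ _ _ _
  (fun k x => maxval (S n x) (fun y => g x y + k%:R * h n x y) - k%:R * maxval (S n x) (h n x))).
  move=> k; apply: measurable_funB; first exact/IH/caratheodoryD.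
  by apply: measurable_funM => //; exact: IH.
move=> x _; have [S0 cS] := lexargmax_prop Xcompact n (@ch x).
by apply: maxval_penalized_cvg => //; exact: gC.2.
Qed.

End measurable_selection.

(** * Borel selection of lexicographic maximizers *)

Section selection.
Context {R : realType} {X : pointedMetricType R}.
Hypothesis Xcompact : compact [set: X].
Context d (A : measurableType d).
Variable h : nat -> A -> X -> R.
Hypothesis hC : forall i, caratheodory (h i).

Lemma measurable_selection n : exists T : A -> borel X,
  measurable_fun setT T /\ forall x, lexargmax (fun i => h i x) n (T x : X).
Proof.
have [q dq] := countable_dense_seq (compact_second_countable Xcompact).
(* Ties are broken by the distances to a dense sequence, which determine a
   point. *)
pose h' i x y := if (i < n)%N then h i x y else - mdist (q (i - n)%N) y.
have h'C i : caratheodory (h' i).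
  rewrite /h'; case: (ltnP i n) => _; first exact: hC.
  by split=> [y|x y]; [exact: measurable_cst|apply: cvgN; exact: mdist_continuous].
have ex x : exists y, forall k, lexargmax (fun i => h' i x) k y.
  by apply: lexargmax_capP => //; [move=> i; exact: (h'C i).2|exact: metric_hausdorff].
have [T lexT] := choice ex.
exists T; split; last first.
  move=> x; have := lexT x n.
  suff H k y : (k <= n)%N -> lexargmax (fun i => h' i x) k y = lexargmax (fun i => h i x) k y.
    by rewrite H.
  elim: k y => [//|k IH] y kn /=.
  have -> : lexargmax (fun i => h' i x) k = lexargmax (fun i => h i x) k.
    by apply/funext => z; apply: IH; exact: ltnW.
  by have -> : h' k x = h k x by rewrite /h' kn.
(* The distance from [q i] to [T x] is minus the maximal value of criterion [n + i] over its stage,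
   which is measurable in [x]. *)
apply: (measurable_to_borel dq) => i.
apply: (@eq_measurable_fun _ _ _ _ _
  (fun x => - maxval (lexargmax (fun i => h' i x) (n + i)) (h' (n + i)%N x))).
  move=> x _; rewrite -(argmax_maxval (lexT x (n + i).+1)) /h'.
  by rewrite ltnNge leq_addr/= addKn opprK.
by apply/measurable_funN; exact: measurable_maxval_lexargmax.
Qed.

End selection.

(** * Integrals of bounded measurable functions *)

Section bounded_measurable.
Context {R : realType} d (T : measurableType d).
Implicit Types (f g : T -> R) (P : probability T R).

Definition bounded_measurable f :=
  measurable_fun setT f /\ exists M, forall x, `|f x| <= M.

Lemma bounded_measurable_cst (k : R) : bounded_measurable (fun=> k).
Proof. by split; [exact: measurable_cst|exists `|k|]. Qed.

Lemma bounded_measurableD f g : bounded_measurable f -> bounded_measurable g ->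
  bounded_measurable (fun x => f x + g x).
Proof.
move=> [mf [M fM]] [mg [N gN]]; split; first exact: measurable_funD.
by exists (M + N) => x; rewrite (le_trans (ler_normD _ _))// lerD.
Qed.

Lemma bounded_measurableZ k f : bounded_measurable f ->
  bounded_measurable (fun x => k * f x).
Proof.
move=> [mf [M fM]]; split; first exact: measurable_funM.
by exists (`|k| * M) => x; rewrite normrM ler_wpM2l.
Qed.

Lemma bounded_measurable_integrable P f : bounded_measurable f ->
  P.-integrable setT (EFin \o f).
Proof.
move=> [mf [M fM]]; apply: measurable_bounded_integrable => //.
  by rewrite -ge0_fin_numE// fin_num_measure.
by exists M; split=> [|N MN x _]; [exact: num_real|exact: le_trans (fM x) (ltW MN)].
Qed.

Lemma EFin_Rintegral P f : bounded_measurable f ->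
  ((\int[P]_x f x)%:E = \int[P]_x (f x)%:E)%E.
Proof.
move=> bf; rewrite fineK//.
exact: (integrable_fin_num measurableT (bounded_measurable_integrable P bf)).
Qed.

Lemma bRintegralD P f g : bounded_measurable f -> bounded_measurable g ->
  \int[P]_x (f x + g x) = \int[P]_x f x + \int[P]_x g x.
Proof. by move=> bf bg; rewrite RintegralD//; exact: bounded_measurable_integrable. Qed.

Lemma bRintegralZ P k f : bounded_measurable f ->
  \int[P]_x (k * f x) = k * \int[P]_x f x.
Proof. by move=> bf; rewrite RintegralZl//; exact: bounded_measurable_integrable. Qed.

Lemma bRintegral_cst P (k : R) : \int[P]_x k = k.
Proof. by rewrite Rintegral_cst//= probability_setT/= mulr1. Qed.

Lemma le_bRintegral P f g : bounded_measurable f -> bounded_measurable g ->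
  (forall x, f x <= g x) -> \int[P]_x f x <= \int[P]_x g x.
Proof.
by move=> bf bg fg; apply: le_Rintegral => //; exact: bounded_measurable_integrable.
Qed.

Lemma bRintegral_cvg P (f : nat -> T -> R) g M :
  (forall n, measurable_fun setT (f n)) -> (forall n x, `|f n x| <= M) ->
  (forall x, f n x @[n --> \oo] --> g x) ->
  bounded_measurable g /\ \int[P]_x f n x @[n --> \oo] --> \int[P]_x g x.
Proof.
move=> mf fM fg; have mg : measurable_fun setT g.
  by apply: (@measurable_fun_cvg _ _ _ _ f) => // x _; exact: fg.
have bg : bounded_measurable g.
  split=> //; exists M => x.
  apply: (@closed_cvg _ _ \oo _ (fun n => `|f n x|) (fun r => r <= M)).
  - exact: closed_le.
  - by apply: nearW => n; exact: fM.
  - by apply: cvg_norm; exact: fg.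
split=> //; apply: fine_cvg; rewrite -/(Rintegral _ _ _) EFin_Rintegral//.
have [|||||_ _] // := @dominated_convergence _ _ _ P _ measurableT
  (fun n => EFin \o f n) (EFin \o g) (EFin \o cst M).
- by move=> n; apply/measurable_EFinP.
- exact/measurable_EFinP.
- by apply: aeW => x _; apply: cvg_EFin; [exact: nearW|exact: fg].
- exact/bounded_measurable_integrable/bounded_measurable_cst.
- by apply: aeW => x n _; rewrite lee_fin.
Qed.

Lemma measure_eq_integral P Q (f : T -> \bar R) : P ≡μ Q ->
  (\int[P]_x f x = \int[Q]_x f x)%E.
Proof. by move=> PQ; apply: eq_measure_integral => A mA _; exact: PQ. Qed.

Lemma measure_eq_Rintegral P Q f : P ≡μ Q -> \int[P]_x f x = \int[Q]_x f x.
Proof. by move=> PQ; rewrite /Rintegral (measure_eq_integral _ PQ). Qed.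

End bounded_measurable.

Lemma bounded_measurable_comp {R : realType} d (T : measurableType d)
    d' (T' : measurableType d') (h : T' -> T) (f : T -> R) :
  measurable_fun setT h -> bounded_measurable f ->
  bounded_measurable (fun x => f (h x)).
Proof.
move=> mh [mf [M fM]]; split; last by exists M.
exact: (measurableT_comp mf mh).
Qed.

(** * Image measures and half-sums of probabilities *)

Section image_probability.
Context {R : realType} d (T : measurableType d) d' (T' : measurableType d').

(** A relation rather than the pushforward itself, so that every representative of an ≡μ-class, such
    as the value of [wasserstein_reg_barycenter], can qualify. *)
Definition is_image (P : probability T R) (h : T -> T') (Q : probability T' R) :=
  forall A, measurable A -> Q A = P (h @^-1` A).

Lemma image_exists (P : probability T R) (h : T -> T') :
  measurable_fun setT h -> exists Q, is_image P h Q.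
Proof.
move=> mh.
pose H : {mfun T >-> T'} := MeasurableFun.Pack
  (MeasurableFun.Class (isMeasurableFun.Build _ _ _ _ _ mh)).
by exists (distribution P H).
Qed.

Lemma Rintegral_image P h Q (f : T' -> R) : measurable_fun setT h ->
  is_image P h Q -> bounded_measurable f ->
  \int[Q]_y f y = \int[P]_x f (h x).
Proof.
move=> mh QE bf.
pose H : {mfun T >-> T'} := MeasurableFun.Pack
  (MeasurableFun.Class (isMeasurableFun.Build _ _ _ _ _ mh)).
have -> : \int[Q]_y f y = \int[distribution P H]_y f y.
  by apply: measure_eq_Rintegral => A mA; exact: QE.
rewrite /Rintegral integral_distribution//.
  by apply/measurable_EFinP; case: bf.
exact/bounded_measurable_integrable/bounded_measurable_comp.
Qed.

Definition mixture (P Q : probability T R) : set T -> \bar R :=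
  mscale (2^-1)%:nng (measure_add P Q).

Section mixture_probability.
Variables P Q : probability T R.

HB.instance Definition _ := Measure.on (mixture P Q).

Lemma mixtureE A : mixture P Q A = (2^-1%:E * (P A + Q A))%E.
Proof. exact: (congr1 (mule 2^-1%:E) (measure_addE P Q A)). Qed.

Let mixture_setT : mixture P Q setT = 1%E.
Proof.
by rewrite mixtureE !probability_setT -EFinD -EFinM; congr (_%:E); lra.
Qed.

HB.instance Definition _ :=
  Measure_isProbability.Build _ _ _ (mixture P Q) mixture_setT.

Lemma ge0_integral_mixture (f : T -> \bar R) : measurable_fun setT f ->
  (forall x, (0 <= f x)%E) ->
  (\int[mixture P Q]_x f x = 2^-1%:E * (\int[P]_x f x + \int[Q]_x f x))%E.
Proof.
by move=> mf f0; rewrite ge0_integral_mscale// ge0_integral_measure_add.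
Qed.

End mixture_probability.
End image_probability.

(** * Integrals of parametrized maxima *)

Section integral_maxval.
Context {R : realType} {X : pointedMetricType R}.
Hypothesis Xcompact : compact [set: X].
Context d (A : measurableType d).

Definition bounded_caratheodory (g : A -> X -> R) :=
  caratheodory g /\ exists M, forall x y, `|g x y| <= M.

Lemma bounded_caratheodoryD g k u : bounded_caratheodory g ->
  bounded_caratheodory u -> bounded_caratheodory (fun x y => g x y + k * u x y).
Proof.
move=> [gC [M gM]] [uC [N uN]]; split; first exact: caratheodoryD.
exists (M + `|k| * N) => x y; rewrite (le_trans (ler_normD _ _))// lerD//.
by rewrite normrM ler_wpM2l.
Qed.

Variable h : nat -> A -> X -> R.
Hypothesis hC : forall i, bounded_caratheodory (h i).

Let ch x i : continuous (h i x).
Proof. exact: (hC i).1.2. Qed.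

Let S n x := lexargmax (fun i => h i x) n.

Lemma maxval_norm_le n x (f : X -> R) M : continuous f ->
  (forall y, `|f y| <= M) -> `|maxval (S n x) f| <= M.
Proof.
move=> cf fM; have [[y Sy] cS] := lexargmax_prop Xcompact n (@ch x).
rewrite ler_norml; apply/andP; split.
  apply: le_trans (le_maxval cS cf Sy).
  by have := fM y; rewrite ler_norml => /andP[].
by apply: maxval_le => [|z _]; [exists y|have := fM z; rewrite ler_norml => /andP[]].
Qed.

Lemma maxval_bounded_measurable n g : bounded_caratheodory g ->
  bounded_measurable (fun x => maxval (S n x) (g x)).
Proof.
move=> [gC [M gM]]; split.
  by apply: measurable_maxval_lexargmax => // i; exact: (hC i).1.
by exists M => x; apply: maxval_norm_le => //; exact: gC.2.
Qed.

(** Dominated convergence for the penalty method: [maxval_penalized_bounds] keeps the integrands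
    within [[-M, M]] for all [k], where [M] bounds [g]. *)
Lemma integral_maxval_penalized_cvg (P : probability A R) n g :
  bounded_caratheodory g ->
  \int[P]_x maxval (S n x) (fun y => g x y + k%:R * h n x y)
    - k%:R * \int[P]_x maxval (S n x) (h n x)
    @[k --> \oo] --> \int[P]_x maxval (S n.+1 x) (g x).
Proof.
move=> bg; have [gC [M gM]] := bg.
have bF k : bounded_measurable (fun x =>
    maxval (S n x) (fun y => g x y + k%:R * h n x y)
    + (- k%:R) * maxval (S n x) (h n x)).
  apply: bounded_measurableD.
    exact/maxval_bounded_measurable/bounded_caratheodoryD.
  by apply: bounded_measurableZ; exact: maxval_bounded_measurable.
have -> : (fun k : nat => \int[P]_x maxval (S n x) (fun y => g x y + k%:R * h n x y)
    - k%:R * \int[P]_x maxval (S n x) (h n x)) =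
  (fun k => \int[P]_x (maxval (S n x) (fun y => g x y + k%:R * h n x y)
    + (- k%:R) * maxval (S n x) (h n x))).
  apply/funext => k; rewrite bRintegralD ?bRintegralZ ?mulNr//.
  - exact: maxval_bounded_measurable.
  - exact/maxval_bounded_measurable/bounded_caratheodoryD.
  - by apply: bounded_measurableZ; exact: maxval_bounded_measurable.
apply: (bRintegral_cvg P (M := M) (fun k => (bF k).1) _ _).2 => [k|] x;
  have [S0 cS] := lexargmax_prop Xcompact n (@ch x); last first.
  by under eq_fun do rewrite mulNr; apply: maxval_penalized_cvg => //; exact: gC.2.
rewrite mulNr.
have /andP[lo hi] := maxval_penalized_bounds k S0 cS (gC.2 x) (@ch x n).
have := maxval_norm_le n.+1 x (gC.2 x) (gM x).
have := maxval_norm_le n x (gC.2 x) (gM x).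
rewrite !ler_norml => /andP[_ hiM] /andP[loM _].
by rewrite (le_trans loM lo) (le_trans hi hiM).
Qed.

End integral_maxval.

(** * Quadratic cost, couplings and weak duality *)

Lemma continuous_bounded_measurable {R : realType} {T : ptopologicalType}
    (f : T -> R) : compact [set: T] -> continuous f ->
  bounded_measurable (f : borel T -> R).
Proof.
move=> cT cf; split; last first.
  exists (maxval setT (fun x => `|f x|)) => x.
  apply: (le_maxval (g := fun x => `|f x|)) => // y.
  by apply: cvg_norm; exact: cf.
apply: (measurability _ (RGenOpens.measurableE R)).
move=> _ [_ [a [b ->] <-]]; rewrite setTI; apply: sub_sigma_algebra.
by apply: open_comp => [y _|]; [exact: cf|exact: interval_open].
Qed.

Section transport.
Context {R : realType} {X : pointedMetricType R}.
Hypothesis Xcompact : compact [set: X].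

Local Notation P := (borel_probability R).

Definition cost (x y : X) : R := mdist x y ^+ 2.

Lemma cost_sym x y : cost x y = cost y x.
Proof. by rewrite /cost metric_sym. Qed.

Lemma cost_continuous : continuous (fun z : X * X => cost z.1 z.2).
Proof.
move=> z; rewrite /cost; apply: (@cvgM _ _ _ _
  (fun z : X * X => mdist z.1 z.2) (fun z : X * X => mdist z.1 z.2)).
- exact: mdist_pair_continuous.
- exact: mdist_pair_continuous.
Qed.

Lemma costr_continuous x : continuous (cost x).
Proof. by move=> y; apply: cvgM; exact: mdist_continuous. Qed.

Lemma pair_compact : compact [set: X * X].
Proof. by rewrite -setXTT; exact: compact_setX. Qed.

Lemma cost_bounded_measurable :
  bounded_measurable (fun z : borel (X * X)%type => cost z.1 z.2).
Proof. exact: (continuous_bounded_measurable pair_compact cost_continuous). Qed.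

Lemma potential_caratheodory (f : X -> R) : continuous f ->
  bounded_caratheodory (fun (_ : borel X) => f).
Proof.
move=> cf; have [mf [M fM]] := continuous_bounded_measurable Xcompact cf.
by split; [split=> // y; exact: measurable_cst|exists M].
Qed.

Lemma cost_caratheodory :
  bounded_caratheodory (fun (x : borel X) y => - cost x y).
Proof.
split; last first.
  have [_ [M cM]] := cost_bounded_measurable.
  by exists M => x y; rewrite normrN; exact: cM (x, y).
split=> [y|x y]; last by apply: cvgN; exact: costr_continuous.
have cy : continuous (fun x => - cost x y : R).
  move=> x; under eq_fun do rewrite cost_sym; apply: cvgN; exact: costr_continuous.
exact: (continuous_bounded_measurable Xcompact cy).1.
Qed.

Lemma measurable_fst_borel : measurable_fun setT (fst : borel (X * X)%type -> borel X).
Proof.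
apply: (@measurability _ _ _ (borel X) setT _ (@open X)) => // _ [U oU <-].
rewrite setTI; apply: sub_sigma_algebra.
by apply: open_comp => // z _; exact: cvg_fst.
Qed.

Lemma measurable_snd_borel : measurable_fun setT (snd : borel (X * X)%type -> borel X).
Proof.
apply: (@measurability _ _ _ (borel X) setT _ (@open X)) => // _ [U oU <-].
rewrite setTI; apply: sub_sigma_algebra.
by apply: open_comp => // z _; exact: cvg_snd.
Qed.

Definition graph (T : borel X -> borel X) (x : borel X) : borel (X * X)%type :=
  (x, T x).

Lemma measurable_graph (T : borel X -> borel X) : measurable_fun setT T ->
  measurable_fun setT (graph T).
Proof.
move=> mT; have [q dq] := countable_dense_seq (compact_second_countable Xcompact).
exact: (measurable_to_borel_pair dq (@measurable_id _ _ _) mT).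
Qed.

Lemma transport_costE (gamma : P (X * X)%type) :
  transport_cost gamma = (\int[gamma]_z cost z.1 z.2)%:E.
Proof. by rewrite EFin_Rintegral//; exact: cost_bounded_measurable. Qed.

Variable m : P X.

Lemma wasserstein_ge nu (r : R) :
  (forall gamma, couplings m nu gamma -> r <= \int[gamma]_z cost z.1 z.2) ->
  (r%:E <= wasserstein2_sq m nu)%E.
Proof.
move=> H; apply: le_ereal_inf_tmp => _ [gamma mnu <-].
by rewrite transport_costE lee_fin; exact: H.
Qed.

Lemma wasserstein_le nu gamma : couplings m nu gamma ->
  (wasserstein2_sq m nu <= (\int[gamma]_z cost z.1 z.2)%:E)%E.
Proof.
by move=> mnu; rewrite -transport_costE; apply: ereal_inf_lbound; exists gamma.
Qed.

Lemma Rintegral_coupling_fst nu gamma (f : borel X -> R) :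
  couplings m nu gamma -> bounded_measurable f ->
  \int[m]_x f x = \int[gamma]_z f z.1.
Proof.
move=> mnu bf; apply: (Rintegral_image measurable_fst_borel) => // A mA.
by rewrite (mnu A mA).1.
Qed.

Lemma Rintegral_coupling_snd nu gamma (f : borel X -> R) :
  couplings m nu gamma -> bounded_measurable f ->
  \int[nu]_x f x = \int[gamma]_z f z.2.
Proof.
move=> mnu bf; apply: (Rintegral_image measurable_snd_borel) => // A mA.
by rewrite (mnu A mA).2.
Qed.

(** Weak Kantorovich duality: [psi y] is at most [k * cost x y] plus the maximum of
    [psi - k * cost x], and this pointwise inequality is integrated against [gamma]. *)
Lemma coupling_bound nu gamma (psi : X -> R) (k : R) : couplings m nu gamma ->
  continuous psi -> 0 <= k ->
  \int[nu]_y psi y <= k * \int[gamma]_z cost z.1 z.2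
    + \int[m]_x maxval setT (fun y => psi y + k * - cost x y).
Proof.
move=> mnu cpsi k0.
have bpsi := continuous_bounded_measurable Xcompact cpsi.
(* Stage [0] is the whole space for any criteria, so zero ones give the measurability of the maximum
   over [setT]. *)
pose h (i : nat) (x : borel X) (y : X) : R := 0.
have hC i : bounded_caratheodory (h i).
  by apply: (potential_caratheodory (f := fun=> 0)); exact: cst_continuous.
have Cg : bounded_caratheodory (fun (x : borel X) y => psi y + k * - cost x y).
  exact: (bounded_caratheodoryD _ (potential_caratheodory cpsi) cost_caratheodory).
have bM := maxval_bounded_measurable Xcompact hC 0 Cg.
rewrite (Rintegral_coupling_snd mnu bpsi) (Rintegral_coupling_fst mnu bM).
have b1 := bounded_measurableZ k cost_bounded_measurable.
have b2 := bounded_measurable_comp measurable_fst_borel bM.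
rewrite -bRintegralZ; last exact: cost_bounded_measurable.
rewrite -bRintegralD//; apply: le_bRintegral.
- exact: (bounded_measurable_comp measurable_snd_borel bpsi).
- exact: bounded_measurableD.
move=> z /=; rewrite -lerBlDl -mulrN.
exact: (le_maxval (g := fun y => psi y + k * - cost z.1 y) Xcompact (Cg.1.2 z.1)).
Qed.

Lemma graph_coupling (T : borel X -> borel X) nu : measurable_fun setT T ->
  is_image m T nu -> exists gamma : P (X * X)%type,
    [/\ is_image m (graph T) gamma, couplings m nu gamma &
        \int[gamma]_z cost z.1 z.2 = \int[m]_x cost x (T x)].
Proof.
move=> mT nuE; have [gamma gE] := image_exists m (measurable_graph mT).
exists gamma; split => //.
  move=> A mA; split; rewrite gE.
  - by [].
  - by rewrite -[X in measurable X]setTI; exact: measurable_fst_borel.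
  - by rewrite nuE.
  - by rewrite -[X in measurable X]setTI; exact: measurable_snd_borel.
by rewrite (Rintegral_image (measurable_graph mT) gE)//; exact: cost_bounded_measurable.
Qed.

End transport.

(** * Nearest points in the minimum set of a potential *)

Section nearest_minimum_points.
Context {R : realType} {X : pointedMetricType R}.
Hypothesis Xcompact : compact [set: X].

Local Notation P := (borel_probability R).

Variables (m : P X) (phi : X -> R).
Hypothesis cphi : continuous phi.

Let cNphi : continuous (fun y => - phi y).
Proof. by move=> y; apply: cvgN; exact: cphi. Qed.

Definition argmin : set X := argmax setT (fun y => - phi y).

Definition minval : R := - maxval setT (fun y => - phi y).

(** The integral over [m] of the squared distance to [argmin], that is, the least cost of
    transporting [m] into [argmin]. *)
Definition nearest_cost : R :=
  - \int[m]_x maxval argmin (fun y => - cost x y).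

Definition nearest (T : borel X -> borel X) :=
  measurable_fun setT T /\
  forall x, argmax argmin (fun y => - cost x y) (T x).

Lemma minval_le y : minval <= phi y.
Proof.
rewrite /minval lerNl; exact: (le_maxval (g := fun y => - phi y) Xcompact cNphi).
Qed.

Lemma argmin_minval y : argmin y -> phi y = minval.
Proof. by move=> /argmax_maxval h; rewrite /minval -h opprK. Qed.

(* The stages of this lexicographic problem are argmin phi, the points of
   argmin phi nearest to x, and those among the latter maximizing f. *)
Definition stages (f : X -> R) (i : nat) (x : borel X) (y : X) : R :=
  match i with 0%N => - phi y | 1%N => - cost x y | _ => f y end.

Lemma stages_caratheodory f i : continuous f -> bounded_caratheodory (stages f i).
Proof.
move=> cf; case: i => [|[|i]]; rewrite /stages.
- exact: (potential_caratheodory Xcompact cNphi).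
- exact: cost_caratheodory.
- exact: (potential_caratheodory Xcompact cf).
Qed.

Lemma nearest_exists (f : X -> R) : continuous f -> exists T : borel X -> borel X,
  nearest T /\ forall x,
    argmax (argmax argmin (fun y => - cost x y)) f (T x).
Proof.
move=> cf.
have sC i : caratheodory (stages f i) by exact: (stages_caratheodory i cf).1.
have [T [mT lexT]] := measurable_selection Xcompact sC 3.
by exists T; split=> [|x]; [split=> // x; exact: (lexT x).1|exact: lexT].
Qed.

Lemma nearest_integral_cost T : nearest T ->
  \int[m]_x cost x (T x) = nearest_cost.
Proof.
move=> [mT nT]; rewrite /nearest_cost -mulN1r -bRintegralZ; last first.
  have cf : continuous (fun _ : X => 0 : R) by exact: cst_continuous.
  exact: (maxval_bounded_measurable Xcompact
    (fun i => stages_caratheodory i cf) 1 (cost_caratheodory Xcompact)).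
by apply: eq_Rintegral => x _; rewrite -(argmax_maxval (nT x)) mulN1r opprK.
Qed.

Lemma nearest_integral_potential T (nu : P X) : nearest T -> is_image m T nu ->
  \int[nu]_y phi y = minval.
Proof.
move=> [mT nT] nuE.
rewrite (Rintegral_image mT nuE); last exact: (continuous_bounded_measurable Xcompact cphi).
under eq_Rintegral => x _ do rewrite (argmin_minval (nT x).1).
exact: bRintegral_cst.
Qed.

(** A measure of minimal potential lives on [argmin], so transporting [m] to it costs at least the
    distance to [argmin]. The proof avoids supports: [coupling_bound] is applied to [- n * phi] with
    cost coefficient [1], and [n] goes to infinity. *)
Lemma wasserstein_ge_nearest_cost (nu : P X) : \int[nu]_y phi y = minval ->
  (nearest_cost%:E <= wasserstein2_sq m nu)%E.
Proof.
move=> nuphi; apply: (wasserstein_ge Xcompact) => gamma mnu.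
have cf : continuous (fun _ : X => 0 : R) by exact: cst_continuous.
have := integral_maxval_penalized_cvg Xcompact (fun i => stages_caratheodory i cf)
   (P := m) (n := 0%N) (cost_caratheodory Xcompact).
rewrite /nearest_cost lerNl => lim.
apply: (@closed_cvg _ _ \oo _ _ (fun r => - (\int[gamma]_z cost z.1 z.2) <= r) _ _ _ lim).
  exact: closed_ge.
apply: nearW => k /=.
have bphi := continuous_bounded_measurable Xcompact cphi.
have ck : continuous (fun y => (- k%:R) * phi y).
  by move=> y; apply: cvgM; [exact: cvg_cst|exact: cphi].
have := coupling_bound Xcompact mnu ck ler01.
rewrite bRintegralZ// nuphi mul1r.
have -> : \int[m]_x maxval setT (fun y => - k%:R * phi y + 1 * - cost x y) =
    \int[m]_x maxval setT (fun y => - cost x y + k%:R * - phi y).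
  apply: eq_Rintegral => x _; apply: eq_maxval => y _.
  by rewrite mul1r mulNr mulrN addrC.
have -> : \int[m]_x maxval setT (fun y => - phi y) = - minval.
  by rewrite bRintegral_cst /minval opprK.
lra.
Qed.

Hypothesis m_regular : regular_mms m.

(** The half-sum of the two graph plans couples [m] with the half-sum of the images at cost
    [nearest_cost], so it is optimal. Regularity puts it on the graph of a single [T], with which
    [T1] and [T2] must then agree up to null sets. *)
Lemma nearest_image_unique T1 T2 (A : set (borel X)) :
  nearest T1 -> nearest T2 -> measurable A ->
  m (T1 @^-1` A) = m (T2 @^-1` A).
Proof.
move=> nT1 nT2 mA; have [mT1 _] := nT1; have [mT2 _] := nT2.
have [nu1 nu1E] := image_exists m mT1.
have [nu2 nu2E] := image_exists m mT2.
have [g1 [g1E c1 cost1]] := graph_coupling Xcompact mT1 nu1E.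
have [g2 [g2E c2 cost2]] := graph_coupling Xcompact mT2 nu2E.
pose nu : P X := mixture nu1 nu2.
pose g : P (X * X)%type := mixture g1 g2.
have halfD (r : R) : (2^-1%:E * (r%:E + r%:E) = r%:E)%E.
  by rewrite -EFinD -EFinM; congr (_%:E); lra.
have cg : couplings m nu g.
  move=> B mB; split.
    rewrite [LHS]mixtureE (c1 B mB).1 (c2 B mB).1.
    by rewrite -(fineK (fin_num_measure m _ mB)) halfD.
  by rewrite [LHS]mixtureE (c1 B mB).2 (c2 B mB).2 [RHS]mixtureE.
have gcost : transport_cost g = nearest_cost%:E.
  rewrite /transport_cost ge0_integral_mixture.
  - have := transport_costE Xcompact g1; have := transport_costE Xcompact g2.
    rewrite /transport_cost => -> ->; rewrite cost1 cost2 !nearest_integral_cost//.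
  - by apply/measurable_EFinP; exact: (cost_bounded_measurable Xcompact).1.
  - by move=> z; rewrite lee_fin sqr_ge0.
have bphi := continuous_bounded_measurable Xcompact cphi.
have bphi' : bounded_measurable (fun y : borel X => phi y + - minval).
  by apply: bounded_measurableD => //; exact: bounded_measurable_cst.
(* Subtracting [minval] makes the integrand nonnegative, as [ge0_integral_mixture] demands. *)
have nuphi : \int[nu]_y phi y = minval.
  apply/eqP; rewrite -subr_eq0; apply/eqP.
  have phi0 (Q : P X) : \int[Q]_y phi y - minval = \int[Q]_y (phi y + - minval).
    rewrite bRintegralD ?bRintegral_cst//; exact: bounded_measurable_cst.
  rewrite phi0; apply: EFin_inj; rewrite EFin_Rintegral// ge0_integral_mixture.
  - rewrite -!EFin_Rintegral// -!phi0 (nearest_integral_potential nT1 nu1E).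
    by rewrite (nearest_integral_potential nT2 nu2E) subrr adde0 mule0.
  - by apply/measurable_EFinP; exact: bphi'.1.
  - by move=> y; rewrite lee_fin subr_ge0 minval_le.
have [|T [mT gT]] := m_regular (nu := nu) (gamma := g).
  split=> //; apply/eqP; rewrite eq_le; apply/andP; split.
    by rewrite gcost wasserstein_ge_nearest_cost.
  by apply: ereal_inf_lbound; exists g.
have half0 (a b : \bar R) : (0 <= a -> 0 <= b -> 2^-1%:E * (a + b) = 0 -> a = 0 /\ b = 0)%E.
  move=> a0 b0 /eqP; rewrite mule_eq0 eqe invr_eq0 pnatr_eq0 orFb.
  by rewrite padde_eq0// => /andP[/eqP -> /eqP ->].
have mpre (S : borel X -> borel X) B : measurable_fun setT S -> measurable B ->
    measurable (S @^-1` B).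
  by move=> mS mB; rewrite -[X in measurable X]setTI; exact: mS.
have diff0 B : measurable B -> m (T1 @^-1` B `\` T @^-1` B) = 0%E /\
    m (T2 @^-1` B `\` T @^-1` B) = 0%E.
  move=> mB.
  (* Pairs [(x, y)] with [y] in [B] but [T x] outside [B]: [g] gives them no mass, hence neither do
     [g1] and [g2]. *)
  pose E : set (borel (X * X)%type) := snd @^-1` B `&` (T \o fst) @^-1` (~` B).
  have mE : measurable E.
    apply: measurableI; rewrite -[X in measurable X]setTI.
      exact: measurable_snd_borel.
    have mTf := measurableT_comp mT (@measurable_fst_borel R X).
    by apply: mTf => //; exact: measurableC.
  have : g E = 0%E.
    rewrite gT// (_ : _ @^-1` E = set0) ?measure0//.
    by apply/seteqP; split=> x //= -[].
  rewrite [LHS]mixtureE g1E// g2E//.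
  by apply: half0.
(* Applied to [A] and to its complement, the assumption makes both differences of the two preimages
   of [A] null. *)
have TT S : measurable_fun setT S ->
    (forall B, measurable B -> m (S @^-1` B `\` T @^-1` B) = 0%E) ->
    m (S @^-1` A) = m (T @^-1` A).
  move=> mS S0.
  have mSA := mpre S A mS mA; have mTA := mpre T A mT mA.
  have dS : m (S @^-1` A) = (m (S @^-1` A `\` T @^-1` A) + m (S @^-1` A `&` T @^-1` A))%E.
    exact: measureDI.
  have dT : m (T @^-1` A) = (m (T @^-1` A `\` S @^-1` A) + m (T @^-1` A `&` S @^-1` A))%E.
    exact: measureDI.
  have eD : T @^-1` A `\` S @^-1` A = S @^-1` (~` A) `\` T @^-1` (~` A).
    by apply/seteqP; split=> x [/= h1 h2]; split => //; exact: contrapT.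
  have i0 : S @^-1` A `&` T @^-1` A = T @^-1` A `&` S @^-1` A by exact: setIC.
  by rewrite dS dT eD (S0 _ mA) (S0 _ (measurableC mA)) i0.
transitivity (m (T @^-1` A)).
  by apply: (TT T1 mT1) => B mB; exact: (diff0 B mB).1.
by apply/esym; apply: (TT T2 mT2) => B mB; exact: (diff0 B mB).2.
Qed.

End nearest_minimum_points.

(** * Near minimizers of the regularized functional *)

Section near_minimizers.
Context {R : realType} {X : pointedMetricType R}.
Hypothesis Xcompact : compact [set: X].

Local Notation P := (borel_probability R).

Variables (m : P X) (phi : X -> R).
Hypothesis cphi : continuous phi.

Lemma minval_le_integral (nu : P X) : minval phi <= \int[nu]_y phi y.
Proof.
rewrite -[leLHS](bRintegral_cst nu); apply: le_bRintegral.
- exact: bounded_measurable_cst.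
- exact: continuous_bounded_measurable.
- exact: minval_le.
Qed.

Hypothesis m_regular : regular_mms m.

(** The assumption on [nu] holds for the minimizers of the regularized functional and also for the
    nearest minimizers of [phi], whence two uses: convergence to the barycenter and its
    uniqueness. *)
Lemma near_minimizer T (f : X -> R) (eta : R) : nearest phi T ->
  continuous f -> 0 < eta -> exists2 eps0 : R, 0 < eps0 &
  forall (nu : P X) (eps : R), 0 < eps <= eps0 ->
    ((\int[nu]_y phi y)%:E + eps%:E * wasserstein2_sq m nu
      <= (minval phi + eps * nearest_cost m phi)%:E)%E ->
    \int[nu]_y f y <= \int[m]_x f (T x) + eta.
Proof.
move=> nT cf eta0.
have [Tf [nTf Tfmax]] := nearest_exists Xcompact cphi cf.
have bf := continuous_bounded_measurable Xcompact cf.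
have bphi := continuous_bounded_measurable Xcompact cphi.
(* [Tf] picks the largest [f] among the nearest points; being a nearest selection, it has the same
   image of [m] as [T]. *)
have fT : \int[m]_x maxval (argmax (argmin phi) (fun y => - cost x y)) f
    = \int[m]_x f (T x).
  transitivity (\int[m]_x f (Tf x)).
    by apply: eq_Rintegral => x _; rewrite (argmax_maxval (Tfmax x)).
  have [nu nuE] := image_exists m nT.1.
  have nufE : is_image m Tf nu.
    by move=> A mA; rewrite nuE//; exact: (nearest_image_unique Xcompact cphi m_regular).
  by rewrite -(Rintegral_image nT.1 nuE)// (Rintegral_image nTf.1 nufE).
have sC i : bounded_caratheodory (stages phi f i) by exact: stages_caratheodory.
have fC := potential_caratheodory Xcompact cf.
have eta20 : 0 < eta / 2 by rewrite divr_gt0.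
(* The weight [k] of the transport cost is chosen first, and the weight [n] of [phi] afterwards,
   depending on [k]. Taking [N.+1] makes them positive. *)
have [k k0 Hk] : exists2 k : nat, 0 < k%:R :> R &
    \int[m]_x maxval (argmin phi) (fun y => f y + k%:R * - cost x y)
      + k%:R * nearest_cost m phi <= \int[m]_x f (T x) + eta / 2.
  have /cvgrPdist_le/(_ _ eta20)[N _ HN] :=
    integral_maxval_penalized_cvg Xcompact sC (P := m) (n := 1%N) fC.
  exists N.+1; first by rewrite ltr0n.
  have := HN N.+1 (leqnSn N).
  rewrite /nearest_cost -[in X in _ -> X]fT/= ler_norml => /andP[+ _].
  by rewrite mulrN; lra.
have fkC := bounded_caratheodoryD k%:R fC (cost_caratheodory Xcompact).
have [n n0 Hn] : exists2 n : nat, 0 < n%:R :> R &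
    \int[m]_x maxval setT (fun y => f y + k%:R * - cost x y + n%:R * - phi y)
      + n%:R * minval phi <=
    \int[m]_x maxval (argmin phi) (fun y => f y + k%:R * - cost x y) + eta / 2.
  have /cvgrPdist_le/(_ _ eta20)[N _ HN] :=
    integral_maxval_penalized_cvg Xcompact sC (P := m) (n := 0%N) fkC.
  exists N.+1; first by rewrite ltr0n.
  have := HN N.+1 (leqnSn N).
  have -> : \int[m]_x maxval setT (fun y => - phi y) = - minval phi.
    by rewrite bRintegral_cst /minval opprK.
  rewrite ler_norml => /andP[+ _].
  by rewrite mulrN /argmin; lra.
(* For [eps <= k / n], an excess of potential of at most [eps * (nearest_cost - w)] becomes at most
   [k * (nearest_cost - w)] once multiplied by [n]. *)
exists (k%:R / n%:R); first exact: divr_gt0.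
move=> nu eps /andP[eps0 epsk] le_eps.
have cpsi : continuous (fun y => f y + (- n%:R) * phi y).
  by move=> y; apply: cvgD; [exact: cf|apply: cvgM; [exact: cvg_cst|exact: cphi]].
set I := \int[m]_x maxval setT (fun y => f y + k%:R * - cost x y + n%:R * - phi y) in Hn.
(* The lower bound on the transport cost that [coupling_bound] gives for [psi = f - n * phi]. *)
pose r : R := ((\int[nu]_y f y) - n%:R * (\int[nu]_y phi y) - I) / k%:R.
have Wge : (r%:E <= wasserstein2_sq m nu)%E.
  apply: (wasserstein_ge Xcompact) => gamma mnu.
  have IE : I = \int[m]_x maxval setT (fun y => f y + (- n%:R) * phi y + k%:R * - cost x y).
    apply: eq_Rintegral => x _; apply: eq_maxval => y _.
    by rewrite mulNr [n%:R * - _]mulrN addrAC.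
  rewrite /r ler_pdivrMr// lerBlDr [X in _ <= X + _]mulrC.
  have := coupling_bound Xcompact mnu cpsi (ltW k0).
  rewrite -IE bRintegralD//; last exact: bounded_measurableZ.
  by rewrite bRintegralZ// mulNr.
have phige := minval_le_integral nu.
case: (wasserstein2_sq m nu) Wge le_eps => [w| |]; last by rewrite leeNy_eq.
  rewrite -EFinM -EFinD !lee_fin /r ler_pdivrMr// => Wge le_eps.
  (* The potential term is at least [minval phi], so the Wasserstein term cannot exceed its
     share. *)
  have lew : eps * w <= eps * nearest_cost m phi by lra.
  rewrite ler_pM2l// in lew.
  have h : (\int[nu]_y phi y) - minval phi <= k%:R / n%:R * (nearest_cost m phi - w).
    apply: le_trans (_ : _ <= eps * (nearest_cost m phi - w)) _.
      by rewrite mulrBr; lra.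
    by rewrite ler_wpM2r// subr_ge0.
  have {}h : n%:R * ((\int[nu]_y phi y) - minval phi) <= k%:R * (nearest_cost m phi - w).
    by rewrite mulrC -ler_pdivlMr// mulrAC.
  move: h Wge; rewrite !mulrBr [w * _]mulrC; lra.
by rewrite gt0_muley ?lte_fin// addey.
Qed.

End near_minimizers.

(** * Continuous test functions and the weak-* topology *)

Section weak_topology.
Context {R : realType} {X : pointedMetricType R}.
Hypothesis Xcompact : compact [set: X].

Local Notation P := (borel_probability R).

Lemma lipschitz_continuous (f : X -> R) (k : R) :
  (forall x y, f x - f y <= k * mdist x y) -> continuous f.
Proof.
move=> fk x; apply/cvgrPdist_lt => e e0.
have d0 : 0 < e / (`|k| + 1) by rewrite divr_gt0// ltr_wpDl.
apply: filterS (nbhsx_ballx x _ d0) => y; rewrite ballEmdist/= => xy.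
have kd : k * mdist x y < e.
  apply: le_lt_trans (_ : (`|k| + 1) * mdist x y < _).
    by rewrite ler_wpM2r ?mdist_ge0// ler_wpDr// ler_norm.
  by rewrite mulrC -ltr_pdivlMr// ltr_wpDl.
rewrite ltr_norml; apply/andP; split; last exact: le_lt_trans (fk x y) kd.
rewrite ltrNl opprB; apply: le_lt_trans (fk y x) _.
by rewrite metric_sym.
Qed.

(** Open sets are stable under intersection and generate the Borel sets; the indicator of an open
    set is a bounded pointwise limit of continuous functions. *)
Lemma measure_eq_continuous (mu nu : P X) :
  (forall f : X -> R, continuous f -> \int[mu]_x f x = \int[nu]_x f x) ->
  mu ≡μ nu.
Proof.
move=> eqf.
have setT1 (Q : P X) : Q setT = 1%E by exact: probability_setT.
suff eqU (U : set X) : open U -> mu U = nu U.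
  move=> A mA; apply: (@measure_unique _ _ (borel X) (@open X) (fun=> setT)) => //.
  - exact: openI.
  - by move=> _; exact: openT.
  - by rewrite bigcup_const.
  - by move=> _; rewrite [X in (X < _)%E]setT1 ltry.
(* The whole space is set apart, since the distance to the complement needs a nonempty
   complement. *)
move=> oU; have [->|UnT] := pselect (U = setT); first by rewrite !setT1.
have C0 : ~` U !=set0.
  by apply/set0P/eqP => U0; apply: UnT; rewrite -[U]setCK U0 setC0.
have cC : compact (~` U) by apply: (subclosed_compact _ Xcompact) => //; exact: open_closedC.
have cNd (x : X) : continuous (fun y : X => - mdist x y : R).
  by move=> y; apply: cvgN; exact: mdist_continuous.
(* minus the distance to the complement of U *)
pose d (x : X) : R := maxval (~` U) (fun y => - mdist x y).
have d_le x z : d x <= d z + mdist x z.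
  apply: maxval_le => // y Cy.
  have zy : - mdist z y <= d z by exact: (le_maxval cC (cNd z) Cy).
  by have := metric_triangle z x y; rewrite (metric_sym z x); lra.
have cd : continuous d.
  by apply: (@lipschitz_continuous _ 1) => x y; rewrite mul1r lerBlDl; exact: d_le.
have d0 x : d x <= 0 by apply: maxval_le => // y _; rewrite oppr_le0 mdist_ge0.
(* [1 - exp (- n * dist)], with [dist] the distance to the complement: it tends to [1] on [U] and
   vanishes outside. *)
pose f n (x : borel X) : R := 1 - expR (d x) ^+ n.
have cf n : continuous (f n : X -> R).
  move=> x; apply: cvgB; first exact: cvg_cst.
  apply: (continuous_comp (f := fun x => expR (d x)) (g := fun r => r ^+ n)).
    by apply: (continuous_comp (f := d)); [exact: cd|exact: continuous_expR].
  exact: exprn_continuous.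
have mU : measurable (U : set (borel X)) by exact: sub_sigma_algebra.
have lim (x : borel X) : f n x @[n --> \oo] --> (\1_U x : R).
  have [Ux|Ux] := pselect (U x).
    rewrite indicE mem_set//= -[X in _ --> X]subr0.
    apply: cvgB; first exact: cvg_cst.
    apply: cvg_expr; rewrite ger0_norm ?expR_ge0// expR_lt1.
    have [y ay] := argmax_neq0 C0 cC (cNd x).
    rewrite /d -(argmax_maxval ay) oppr_lt0 mdist_gt0.
    by apply/eqP => xy; apply: ay.1; rewrite -xy.
  rewrite indicE memNset//=.
  have dx : d x = 0.
    apply/eqP; rewrite eq_le d0/=.
    have : - mdist x x <= d x by exact: (le_maxval cC (cNd x) Ux).
    by rewrite mdistxx oppr0.
  rewrite /f dx expR0; under eq_fun do rewrite expr1n subrr.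
  exact: cvg_cst.
have fin (Q : P X) : \int[Q]_x f n x @[n --> \oo] --> \int[Q]_x (\1_U x : R).
  apply: (bRintegral_cvg Q (M := 1) _ _ lim).2 => [n|n x].
    exact: (continuous_bounded_measurable Xcompact (cf n)).1.
  have e1 : 0 <= expR (d x) ^+ n <= 1.
    by rewrite exprn_ge0 ?expR_ge0//= exprn_ile1 ?expR_ge0// -expR0 ler_expR.
  by rewrite /f ger0_norm; lra.
have UE (Q : P X) : Q U = (\int[Q]_x (\1_U x : R))%:E.
  rewrite EFin_Rintegral.
    by rewrite integral_indic// setIT.
  split; first exact: measurable_indic.
  by exists 1 => x; rewrite indicE; case: (_ \in _); rewrite ?normr1 ?normr0.
rewrite !UE; congr (_%:E).
apply: (cvg_unique _ (fin mu)) => //.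
have -> : (fun n => \int[mu]_x f n x) = (fun n => \int[nu]_x f n x).
  by apply/funext => n; exact: eqf.
exact: fin.
Qed.

(** Convergence of every coordinate gives convergence in the product, and the weak-* topology is the
    initial one for [integral_against]. *)
Lemma borel_probability_cvg (I : Type) (F : set_system I) (u : I -> P X)
    (nu : P X) : Filter F ->
  (forall f : X -> R, continuous f ->
    \int[u i]_x f x @[i --> F] --> \int[nu]_x f x) ->
  u i @[i --> F] --> nu.
Proof.
move=> FF cvf.
have lim : integral_against (u i) @[i --> F] --> integral_against nu.
  apply/cvg_sup => f A [_ [[B oB <-] Bf] BA].
  have := cvf _ (svalP f); move=> /(_ B); rewrite nbhs_simpl.
  have Bn : nbhs (\int[nu]_x (sval f) x) B by exact: open_nbhs_nbhs.
  by move=> /(_ Bn) FB; apply: (@filterS _ F FF _ _ _ FB) => i Bi; exact: BA.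
move=> A [_ [[B oB <-] Bnu] BA].
have Bn : nbhs (integral_against nu) B by exact: open_nbhs_nbhs.
by apply: (@filterS _ F FF _ _ _ (lim B Bn)) => i Bi; exact: BA.
Qed.

Lemma borel_probability_cvg_integral (I : Type) (F : set_system I)
    (u : I -> P X) (nu : P X) (f : X -> R) : Filter F -> continuous f ->
  u i @[i --> F] --> nu -> \int[u i]_x f x @[i --> F] --> \int[nu]_x f x.
Proof.
move=> FF cf lim.
have lim2 : integral_against (u i) @[i --> F] --> integral_against nu.
  exact: cvg_comp lim (@initial_continuous _ _ (@integral_against R X) nu).
pose e (g : prod_topology (fun _ : {f : X -> R | continuous f} => R)) :=
  g (exist _ f cf).
have /cvg_sup/(_ (exist _ f cf)) lim3 := lim2.
move=> B; rewrite nbhsE => -[V [oV Vn] VB].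
apply: (lim3 (e @^-1` B)); exists (e @^-1` V).
by split; [exists V|exact: Vn|move=> g; exact: VB].
Qed.

End weak_topology.

(** * Potentials of measures and the regularized barycenter *)

Section barycenter.
Context {R : realType} {X : pointedMetricType R}.
Hypothesis Xcompact : compact [set: X].

Local Notation P := (borel_probability R).

Definition potential (mu : P X) (y : X) : R := \int[mu]_x cost y x.

Lemma cost_slice_bounded_measurable (y : X) :
  bounded_measurable (fun x : borel X => cost y x).
Proof. exact: (continuous_bounded_measurable Xcompact (@costr_continuous R X y)). Qed.

(** Lipschitz bound from the difference of two squares: the sum of the distances is at most [M + M],
    and their difference at most [mdist y z]. *)
Lemma potential_continuous mu : continuous (potential mu).
Proof.
have [_ [M dM]] := continuous_bounded_measurable (pair_compact Xcompact)
  (@mdist_pair_continuous R X).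
have {}dM (x y : X) : mdist x y <= M.
  by apply: le_trans (dM (x, y)); exact: ler_norm.
apply: (@lipschitz_continuous _ _ _ (M + M)) => y z.
have bc := cost_slice_bounded_measurable.
have -> : potential mu y - potential mu z = \int[mu]_x (cost y x + -1 * cost z x).
  rewrite bRintegralD// ?bRintegralZ ?mulN1r//; exact: bounded_measurableZ.
rewrite -[leRHS](bRintegral_cst mu); apply: le_bRintegral.
- by apply: bounded_measurableD => //; exact: bounded_measurableZ.
- exact: bounded_measurable_cst.
move=> x; rewrite /cost mulN1r subr_sqr mulrC.
have ge0 := @mdist_ge0 R X.
have M0 : 0 <= M by exact: le_trans (ge0 y y) (dM y y).
apply: (@le_trans _ _ ((mdist y x + mdist z x) * mdist y z)).
  apply: ler_wpM2l; first exact: addr_ge0.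
  by rewrite lerBlDr; exact: metric_triangle.
by apply: ler_wpM2r => //; exact: lerD.
Qed.

(** Tonelli; the cost is measurable for the product sigma-algebra by [measurable_to_borel_pair]. *)
Lemma potential_sym (mu nu : P X) :
  \int[nu]_y potential mu y = \int[mu]_y potential nu y.
Proof.
apply: EFin_inj; rewrite !EFin_Rintegral; try exact:
  (continuous_bounded_measurable Xcompact (@potential_continuous _)).
rewrite /potential.
under eq_integral => y _ do
  rewrite (EFin_Rintegral mu (cost_slice_bounded_measurable y)).
under [RHS]eq_integral => y _ do
  rewrite (EFin_Rintegral nu (cost_slice_bounded_measurable y)).
have [q dq] := countable_dense_seq (compact_second_countable Xcompact).
have mpair : measurable_fun setT
    (fun z : (borel X * borel X)%type => (cost z.1 z.2)%:E).
  apply/measurable_EFinP.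
  have mid := measurable_to_borel_pair dq (@measurable_fst _ _ (borel X) (borel X))
    (@measurable_snd _ _ (borel X) (borel X)).
  exact: (measurableT_comp (cost_bounded_measurable Xcompact).1 mid).
rewrite (fubini_tonelli (m1 := nu) (m2 := mu) (fun z => (cost z.1 z.2)%:E))//=.
  by apply: eq_integral => x _; apply: eq_integral => y _; rewrite cost_sym.
by move=> z; rewrite lee_fin sqr_ge0.
Qed.

Lemma measure_eq_potential (mu nu : P X) : mu ≡μ nu -> potential mu = potential nu.
Proof. by move=> e; apply/funext => y; exact: measure_eq_Rintegral. Qed.

Variable m : P X.

Lemma measure_eq_wasserstein (mu nu : P X) : mu ≡μ nu ->
  wasserstein2_sq m mu = wasserstein2_sq m nu.
Proof.
move=> e; congr (ereal_inf (_ @` _)); apply/seteqP; split=> g cg A mA.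
  by rewrite -(e A mA); exact: cg.
by rewrite (e A mA); exact: cg.
Qed.

Lemma regularized_functionalE mu eps nu :
  regularized_functional m mu eps nu =
  ((\int[nu]_y potential mu y)%:E + eps%:E * wasserstein2_sq m nu)%E.
Proof.
rewrite /regularized_functional EFin_Rintegral; last first.
  exact: (continuous_bounded_measurable Xcompact (@potential_continuous _)).
congr (_ + _)%E; apply: eq_integral => y _.
by rewrite EFin_Rintegral//; exact: cost_slice_bounded_measurable.
Qed.

Lemma nearest_wasserstein_le phi T nu : continuous phi -> nearest phi T ->
  is_image m T nu -> (wasserstein2_sq m nu <= (nearest_cost m phi)%:E)%E.
Proof.
move=> cphi nT nuE.
have [gamma [_ mnu gE]] := graph_coupling Xcompact nT.1 nuE.
rewrite -(nearest_integral_cost Xcompact m cphi nT) -gE.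
exact: (wasserstein_le Xcompact).
Qed.

(** For [get] to return a minimizer, one must exist. It is the image of [m] by a Borel map sending
    [x] to a maximizer of [- potential mu y - eps * cost x y]; optimality is [coupling_bound]. *)
Lemma regularized_minimizer_le mu eps nu : 0 < eps ->
  (regularized_functional m mu eps (regularized_minimizer m mu eps)
    <= regularized_functional m mu eps nu)%E.
Proof.
move=> eps0; rewrite /regularized_minimizer.
set S := [set _ | _].
suff [nu0 Snu0] : exists nu0, S nu0 by exact: (getI Snu0).
have cphi := @potential_continuous mu.
have cN : continuous (fun y => - potential mu y).
  by move=> y; apply: cvgN; exact: cphi.
have bphi := continuous_bounded_measurable Xcompact cphi.
pose h (x : borel X) (y : X) := - potential mu y + eps * - cost x y.
have hC : bounded_caratheodory h.
  exact: (bounded_caratheodoryD eps (potential_caratheodory Xcompact cN)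
    (cost_caratheodory Xcompact)).
have [T [mT lexT]] := measurable_selection Xcompact (fun _ : nat => hC.1) 1.
have [nu0 nu0E] := image_exists m mT.
exists nu0 => nu'; rewrite !regularized_functionalE.
have [gamma [_ mnu gE]] := graph_coupling Xcompact mT nu0E.
pose I := \int[m]_x maxval setT (h x).
have bcost : bounded_measurable (fun x : borel X => cost x (T x)).
  exact: (bounded_measurable_comp (measurable_graph Xcompact mT)
    (cost_bounded_measurable Xcompact)).
(* The functional is at most [- I] at [nu0] and at least [- I] at [nu']. *)
apply: (@le_trans _ _ (- I)%:E).
  apply: (@le_trans _ _ ((\int[nu0]_y potential mu y)%:E
      + eps%:E * (\int[m]_x cost x (T x))%:E)%E).
    apply: leeD2l; apply: lee_wpmul2l; first by rewrite lee_fin ltW.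
    by rewrite -gE; exact: (wasserstein_le Xcompact).
  rewrite -EFinM -EFinD lee_fin (Rintegral_image mT nu0E bphi).
  rewrite -bRintegralZ// -bRintegralD; last 2 first.
  - exact: (bounded_measurable_comp mT bphi).
  - exact: bounded_measurableZ.
  rewrite -mulN1r /I -bRintegralZ; last first.
    exact: (maxval_bounded_measurable Xcompact (fun _ : nat => hC) 0 hC).
  rewrite le_eqVlt; apply/orP; left; apply/eqP; apply: eq_Rintegral => x _.
  by rewrite -(argmax_maxval (lexT x)) /h; lra.
have Wge : (((- (\int[nu']_y potential mu y) - I) / eps)%:E <= wasserstein2_sq m nu')%E.
  apply: (wasserstein_ge Xcompact) => g mg; rewrite ler_pdivrMr// lerBlDr mulrC.
  have := coupling_bound Xcompact mg cN (ltW eps0).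
  have -> : \int[nu']_y (- potential mu y) = - \int[nu']_y potential mu y.
    by under eq_Rintegral do rewrite -mulN1r; rewrite bRintegralZ// mulN1r.
  by [].
case: (wasserstein2_sq m nu') Wge => [w| |]; last by rewrite leeNy_eq.
  by rewrite -EFinM -EFinD !lee_fin ler_pdivrMr//; lra.
by move=> _; rewrite gt0_muley ?lte_fin// addey// leey.
Qed.

Hypothesis m_regular : regular_mms m.

(** Such a [nu'] satisfies the assumption of [near_minimizer] for every [eps], so no integral of a
    continuous [f] exceeds that against [nu]; the same for [- f] gives equality. *)
Lemma nearest_image_characterization phi T (nu nu' : P X) : continuous phi ->
  nearest phi T -> is_image m T nu -> \int[nu']_y phi y = minval phi ->
  (wasserstein2_sq m nu' <= (nearest_cost m phi)%:E)%E -> nu' ≡μ nu.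
Proof.
move=> cphi nT nuE nu'phi W'.
have le f : continuous f -> \int[nu']_y f y <= \int[nu]_y f y.
  move=> cf; rewrite (Rintegral_image nT.1 nuE); last exact: continuous_bounded_measurable.
  apply/ler_addgt0Pr => eta eta0.
  have [eps0 eps00 H] := near_minimizer Xcompact cphi m_regular nT cf eta0.
  apply: (H nu' eps0); first by rewrite eps00/=.
  rewrite nu'phi EFinD EFinM; apply: leeD2l; apply: lee_wpmul2l => //.
  by rewrite lee_fin ltW.
apply: (measure_eq_continuous Xcompact) => f cf.
apply/eqP; rewrite eq_le le//=.
have cN : continuous (fun y => - f y) by move=> y; apply: cvgN; exact: cf.
have bf := continuous_bounded_measurable Xcompact cf.
have intN (Q : P X) : \int[Q]_y (- f y) = - \int[Q]_y f y.
  by under eq_Rintegral do rewrite -mulN1r; rewrite bRintegralZ// mulN1r.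
by have := le _ cN; rewrite !intN lerN2.
Qed.

(** Comparing the regularized minimizers with the image of [m] by [T] makes [near_minimizer]
    applicable; used for [f] and [- f], it gives convergence to that image. *)
Lemma barycenter_nearest mu : exists T,
  nearest (potential mu) T /\ is_image m T (wasserstein_reg_barycenter m mu).
Proof.
have cphi := @potential_continuous mu.
have [T [nT _]] := nearest_exists Xcompact cphi cphi.
have [nu nuE] : exists nu : P X, is_image m T nu by exact: image_exists nT.1.
exists T; split=> //.
pose u eps := regularized_minimizer m mu eps.
have ule eps : 0 < eps -> ((\int[u eps]_y potential mu y)%:E + eps%:E * wasserstein2_sq m (u eps)
    <= (minval (potential mu) + eps * nearest_cost m (potential mu))%:E)%E.
  move=> eps0; have := regularized_minimizer_le mu nu eps0.
  rewrite !regularized_functionalE => /le_trans; apply.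
  rewrite (nearest_integral_potential Xcompact cphi nT nuE) EFinD EFinM.
  apply: leeD2l; apply: lee_wpmul2l; first by rewrite lee_fin ltW.
  exact: nearest_wasserstein_le nuE.
have near f eta : continuous f -> 0 < eta ->
    \forall eps \near 0^'+, \int[u eps]_y f y <= \int[nu]_y f y + eta.
  move=> cf eta0.
  have [eps0 eps00 H] := near_minimizer Xcompact cphi m_regular nT cf eta0.
  rewrite (Rintegral_image nT.1 nuE); last exact: continuous_bounded_measurable.
  near=> eps; apply: (H _ eps).
    by apply/andP; split; near: eps; [exact: nbhs_right_gt|exact: nbhs_right_le].
  by apply: ule; near: eps; exact: nbhs_right_gt.
have ulim : u eps @[eps --> 0^'+] --> nu.
  apply: borel_probability_cvg => f cf; apply/cvgrPdist_le => eta eta0.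
  have cN : continuous (fun y => - f y) by move=> y; apply: cvgN; exact: cf.
  have bf := continuous_bounded_measurable Xcompact cf.
  have intN (Q : P X) : \int[Q]_y (- f y) = - \int[Q]_y f y.
    by under eq_Rintegral do rewrite -mulN1r; rewrite bRintegralZ// mulN1r.
  near=> eps.
  have h1 : \int[u eps]_y f y <= \int[nu]_y f y + eta by near: eps; exact: near.
  have : \int[u eps]_y (- f y) <= \int[nu]_y (- f y) + eta by near: eps; exact: near.
  by rewrite !intN ler_norml => h2; apply/andP; split; lra.
(* Convergence of [u] makes [lim] a genuine limit. Limits being unique only up to ≡μ, it is compared
   with [nu] through integrals. *)
have Blim : u eps @[eps --> 0^'+] --> wasserstein_reg_barycenter m mu.
  by apply: cvgP ulim.
have Bnu : wasserstein_reg_barycenter m mu ≡μ nu.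
  apply: (measure_eq_continuous Xcompact) => f cf.
  apply: (cvg_unique _ (borel_probability_cvg_integral _ cf Blim)) => //.
  exact: borel_probability_cvg_integral _ cf ulim.
by move=> A mA; rewrite -nuE//; exact: Bnu.
Unshelve. all: by end_near. Qed.

End barycenter.

(** * Periodic points of the barycenter map *)

Section iterated_barycenter.
Context {R : realType} {X : pointedMetricType R}.
Hypothesis Xcompact : compact [set: X].

Local Notation P := (borel_probability R).

Variable m : P X.
Hypothesis m_regular : regular_mms m.

Let B := wasserstein_reg_barycenter m.

Lemma barycenter_integral_potential (mu : P X) :
  \int[B mu]_y potential mu y = minval (potential mu).
Proof.
have [T [nT BE]] := barycenter_nearest Xcompact m_regular mu.
exact: (nearest_integral_potential Xcompact (potential_continuous Xcompact (mu := mu)) nT BE).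
Qed.

Lemma barycenter_wasserstein_le (mu : P X) :
  (wasserstein2_sq m (B mu) <= (nearest_cost m (potential mu))%:E)%E.
Proof.
have [T [nT BE]] := barycenter_nearest Xcompact m_regular mu.
exact: (nearest_wasserstein_le Xcompact (potential_continuous Xcompact (mu := mu)) nT BE).
Qed.

Lemma barycenter_unique (mu nu : P X) :
  \int[nu]_y potential mu y = minval (potential mu) ->
  (wasserstein2_sq m nu <= (nearest_cost m (potential mu))%:E)%E ->
  nu ≡μ B mu.
Proof.
have [T [nT BE]] := barycenter_nearest Xcompact m_regular mu.
exact: (nearest_image_characterization Xcompact m_regular
  (potential_continuous Xcompact (mu := mu)) nT BE).
Qed.

(** [B] picks representatives, so its compatibility with ≡μ has to come from uniqueness; it lets
    periodicity up to ≡μ propagate along the orbit. *)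
Lemma barycenter_measure_eq (mu nu : P X) : mu ≡μ nu -> B mu ≡μ B nu.
Proof.
move=> e; apply: barycenter_unique; rewrite -(measure_eq_potential e).
  exact: barycenter_integral_potential.
exact: barycenter_wasserstein_le.
Qed.

Lemma barycenter_periodic (mu : P X) N : (0 < N)%N -> iter N B mu ≡μ mu ->
  iter 2 B mu ≡μ mu.
Proof.
move=> N0 per.
have perD k : iter (k + N) B mu ≡μ iter k B mu.
  by elim: k => [//|k IH]; rewrite addSn !iterS; exact: barycenter_measure_eq.
pose a k := minval (potential (iter k B mu)).
have swap k : \int[iter k B mu]_y potential (iter k.+1 B mu) y = a k.
  by rewrite (potential_sym Xcompact); exact: barycenter_integral_potential.
have a_decr k : a k.+1 <= a k.
  by rewrite -(swap k); apply: minval_le_integral => //; exact: potential_continuous.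
have a_decrD j k : a (j + k)%N <= a k.
  by elim: j => [//|j IH]; rewrite addSn; exact: le_trans (a_decr _) IH.
have a_per k : a (k + N)%N = a k by rewrite /a (measure_eq_potential (perD k)).
(* [a k = a (k + N)], which is [N - 1] nonincreasing steps after [a k.+1]. *)
have a_cst k : a k.+1 = a k.
  apply/eqP; rewrite eq_le a_decr/= -[leLHS]a_per -{1}(prednK N0) addnS -addSn addnC.
  exact: a_decrD.
pose w k := wasserstein2_sq m (iter k B mu).
have w_le k : ((nearest_cost m (potential (iter k.+1 B mu)))%:E <= w k)%E.
  apply: wasserstein_ge_nearest_cost => //; first exact: potential_continuous.
  by rewrite swap -a_cst.
have w_decr k : (w k.+2 <= w k)%E.
  exact: le_trans (barycenter_wasserstein_le _) (w_le k).
have w_decrD j : (w (j.*2 + 2)%N <= w 2%N)%E.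
  by elim: j => [//|j IH]; rewrite doubleS !addSn; exact: le_trans (w_decr _) IH.
(* Distances to [m] are compared two iterates apart, so two periods are covered, with
   [2N = 2(N - 1) + 2]. *)
have w0 : (w 0%N <= w 2%N)%E.
  have <- : w N.*2 = w 0%N.
    apply: measure_eq_wasserstein => A mA.
    by rewrite -addnn (perD N A mA) (per A mA).
  by have := w_decrD N.-1; rewrite addn2 -doubleS prednK.
move=> A mA; apply/esym; move: A mA.
(* Uniqueness is used for the potential of [B mu], of which [mu] is a minimizer by the constancy of
   [a]. *)
apply: barycenter_unique; first by rewrite (swap 0%N) -a_cst.
exact: le_trans w0 (barycenter_wasserstein_le _).
Qed.

End iterated_barycenter.

Local Close Scope ring_scope.

Theorem corollary3p6 (R : realType) (X : pointedMetricType R)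
    (X_compact : compact [set: X])
    (m : borel_probability R X) (m_regular : regular_mms m)
    (mu : borel_probability R X) (N : nat) (N_gt0 : (0 < N)%N)
    (periodic : iter N (wasserstein_reg_barycenter m) mu ≡μ mu) :
  iter 2 (wasserstein_reg_barycenter m) mu ≡μ mu.
Proof. exact: (barycenter_periodic X_compact m_regular N_gt0 periodic). Qed.
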